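(* Let $\mathcal X_1,\mathcal X_2,\mathcal Y_1,\mathcal Y_2$ be finite nonempty sets. For any jointly supported prior $\pi$ on $\mathcal X_1\times\mathcal X_2$ with marginals $\pi_1,\pi_2$, and any two channels $(\mathcal X_1,\mathcal Y_1,C_1)$ and $(\mathcal X_2,\mathcal Y_2,C_2)$: (1) $I_\infty(\pi,C_1\times C_2)\ \ge\ I_\infty(\pi_1,C_1)+I_\infty(\pi_2,C_2)-\log\frac{M^{\max}_{\infty,\pi}}{M^{\min}_{\infty,\pi}}$; (2) $I_\infty(\pi,C_1\times C_2)\ \le\ I_\infty(\pi_1,C_1)+I_\infty(\pi_2,C_2)+\log\frac{M^{\max}_{\infty,\pi}}{M^{\min}_{\infty,\pi}}$; (3) if $\pi=\pi_1\times\pi_2$ (i.e. $\pi[x_1,x_2]=\pi_1[x_1]\pi_2[x_2]$ for all $x_1,x_2$), then $I_\infty(\pi_1\times\pi_2,C_1\times C_2)=I_\infty(\pi_1,C_1)+I_\infty(\pi_2,C_2)$.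
   Context: A (discrete) channel $(\mathcal X,\mathcal Y,C)$ consists of finite sets $\mathcal X,\mathcal Y$ and a matrix $C$ with entries $C[x,y]\ge 0$ and $\sum_{y}C[x,y]=1$ for each $x$. A prior on $\mathcal X$ is a probability distribution on $\mathcal X$. The parallel composition (with distinct inputs) $C_1\times C_2$ is the channel from $\mathcal X_1\times\mathcal X_2$ to $\mathcal Y_1\times\mathcal Y_2$ with $(C_1\times C_2)[(x_1,x_2),(y_1,y_2)]=C_1[x_1,y_1]\,C_2[x_2,y_2]$. $V(\pi)=\max_{x}\pi[x]$, $V(\pi,C)=\sum_y\max_x\pi[x]C[x,y]$, $H_\infty(\pi)=-\log V(\pi)$, $H_\infty(\pi,C)=-\log V(\pi,C)$, and the min-entropy leakage is $I_\infty(\pi,C)=H_\infty(\pi)-H_\infty(\pi,C)$. Logarithms are to base 2. The marginals of $\pi$ are $\pi_1[x_1]=\sum_{x_2}\pi[x_1,x_2]$ and $\pi_2[x_2]=\sum_{x_1}\pi[x_1,x_2]$. $\pi$ is jointly supported if for all $x_1,x_2$, $\pi_1[x_1]\pi_2[x_2]\ne 0$ implies $\pi[x_1,x_2]\neq 0$. $M^{\min}_{\infty,\pi}$ (resp. $M^{\max}_{\infty,\pi}$) is the minimum (resp. maximum) of $\frac{\pi_1[x_1]\pi_2[x_2]}{\pi[x_1,x_2]}$ over all $(x_1,x_2)$ with $\pi[x_1,x_2]\ne0$. *)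

(* Defs.v *)
From mathcomp Require Import all_boot all_order all_algebra.
From mathcomp Require Import all_classical all_reals all_analysis.

Set Implicit Arguments.
Unset Strict Implicit.
Unset Printing Implicit Defensive.

Import Order.TTheory GRing.Theory Num.Theory.

Local Open Scope ring_scope.

Section SingleChannel.
Context {R : realType} {X Y : finType}.

Definition is_prior (pi : X -> R) : Prop :=
  (forall x, 0 <= pi x) /\ \sum_x pi x = 1.

Definition is_channel (C : X -> Y -> R) : Prop :=
  (forall x y, 0 <= C x y) /\ (forall x, \sum_y C x y = 1).

(* The maxima below are over nonnegative families indexed by a nonempty type,
   for which the initial value 0 of the iterated maximum is neutral. *)
Definition vulnerability (pi : X -> R) : R := \big[Num.max/0]_x pi x.

Definition cond_vulnerability (pi : X -> R) (C : X -> Y -> R) : R :=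
  \sum_y \big[Num.max/0]_x (pi x * C x y).

Definition log2 (x : R) : R := ln x / ln 2.

Definition min_entropy (pi : X -> R) : R := - log2 (vulnerability pi).

Definition cond_min_entropy (pi : X -> R) (C : X -> Y -> R) : R :=
  - log2 (cond_vulnerability pi C).

Definition min_entropy_leakage (pi : X -> R) (C : X -> Y -> R) : R :=
  min_entropy pi - cond_min_entropy pi C.

End SingleChannel.

Section JointPrior.
Context {R : realType} {X1 X2 : finType}.
Implicit Types (pi : X1 * X2 -> R).

Definition marginal1 pi (x1 : X1) : R := \sum_(x2 : X2) pi (x1, x2).

Definition marginal2 pi (x2 : X2) : R := \sum_(x1 : X1) pi (x1, x2).

Definition prod_prior (pi1 : X1 -> R) (pi2 : X2 -> R) (x : X1 * X2) : R :=
  pi1 x.1 * pi2 x.2.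

Definition jointly_supported pi : Prop :=
  forall x1 x2, marginal1 pi x1 * marginal2 pi x2 != 0 -> pi (x1, x2) != 0.

Definition dependence_ratio pi (x : X1 * X2) : R :=
  marginal1 pi x.1 * marginal2 pi x.2 / pi x.

Definition Mmax pi : R :=
  \big[Num.max/0]_(x | pi x != 0) dependence_ratio pi x.

(* The initial value Mmax pi is an upper bound of the ratios, hence neutral:
   this is their minimum as soon as the support of pi is nonempty. *)
Definition Mmin pi : R :=
  \big[Num.min/Mmax pi]_(x | pi x != 0) dependence_ratio pi x.

End JointPrior.

Definition parallel {R : realType} {X1 X2 Y1 Y2 : finType}
    (C1 : X1 -> Y1 -> R) (C2 : X2 -> Y2 -> R) (x : X1 * X2) (y : Y1 * Y2) : R :=
  C1 x.1 y.1 * C2 x.2 y.2.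

(* Main.v *)
(** Write [q] for the product of the marginals of [pi]. Vulnerability and
    conditional vulnerability are multiplicative on products and monotone and
    homogeneous in the prior, while joint support gives
    [Mmin * pi <= q <= Mmax * pi] pointwise. Hence replacing [pi] by [q] changes
    each of the two vulnerabilities by a factor in [[Mmin, Mmax]], and their
    quotient by a factor at most [Mmax / Mmin]. *)

Require Import Defs.
From mathcomp Require Import all_boot all_order all_algebra.
From mathcomp Require Import all_classical all_reals all_analysis.
From mathcomp Require Import lra.

Set Implicit Arguments.
Unset Strict Implicit.
Unset Printing Implicit Defensive.

Import Order.TTheory GRing.Theory Num.Theory.

Local Open Scope ring_scope.

Section BigmaxNonneg.
Context {R : realType}.

(** Multiplication by [c >= 0] is monotone, so it commutes with binary maxima, and it fixes the
    initial value 0. *)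
Lemma bigmax_mulrr (I : finType) (c : R) (f : I -> R) : 0 <= c ->
  \big[Num.max/0]_i (c * f i) = c * \big[Num.max/0]_i f i.
Proof.
move=> c0; rewrite (big_morph ( *%R c) (op1 := Num.max) (id1 := 0)) ?mulr0 //.
by move=> x y; rewrite maxr_pMr.
Qed.

Lemma ler_bigmax (I : finType) (f g : I -> R) : (forall i, f i <= g i) ->
  \big[Num.max/0]_i f i <= \big[Num.max/0]_i g i.
Proof. by move=> fg; apply: le_bigmax2. Qed.

Lemma bigmax_ge0 (I : finType) (f : I -> R) : 0 <= \big[Num.max/0]_i f i.
Proof. exact: bigmax_ge_id. Qed.

Lemma bigmax_prod (I J : finType) (f : I -> R) (g : J -> R) :
  (forall i, 0 <= f i) -> (forall j, 0 <= g j) ->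
  \big[Num.max/0]_(p : I * J) (f p.1 * g p.2) =
  \big[Num.max/0]_i f i * \big[Num.max/0]_j g j.
Proof.
move=> f0 g0; apply/le_anti/andP; split.
  apply: bigmax_le => [|p _]; first by rewrite mulr_ge0 ?bigmax_ge0.
  by rewrite ler_pM //; apply: le_bigmax.
(* Conversely, each factor is nonnegative and can be moved inside the other maximum, one index at a
   time, until only single entries [f i * g j] remain. *)
rewrite mulrC -bigmax_mulrr ?bigmax_ge0 //.
apply: bigmax_le => [|i _]; first exact: bigmax_ge0.
rewrite mulrC -bigmax_mulrr //; apply: bigmax_le => [|j _].
  exact: bigmax_ge0.
exact: (le_bigmax _ (fun p : I * J => f p.1 * g p.2) (i, j)).
Qed.

End BigmaxNonneg.

Section Vulnerability.
Context {R : realType} {X Y : finType}.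
Implicit Types (p q : X -> R) (C : X -> Y -> R).

Lemma vulnerability_le (c d : R) p q : 0 <= c -> 0 <= d ->
  (forall x, c * p x <= d * q x) ->
  c * vulnerability p <= d * vulnerability q.
Proof. by move=> c0 d0 pq; rewrite -!bigmax_mulrr //; apply: ler_bigmax. Qed.

Lemma cond_vulnerability_le (c d : R) p q C : is_channel C ->
  0 <= c -> 0 <= d -> (forall x, c * p x <= d * q x) ->
  c * cond_vulnerability p C <= d * cond_vulnerability q C.
Proof.
move=> [C0 _] c0 d0 pq; rewrite !mulr_sumr; apply: ler_sum => y _.
rewrite -!bigmax_mulrr //; apply: ler_bigmax => x.
by rewrite !mulrA ler_wpM2r.
Qed.

Lemma prior_gt0 p : is_prior p -> exists x, 0 < p x.
Proof.
move=> [p0 p1]; apply: contrapT => /forallNP np.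
have : \sum_x p x = 0.
  apply: big1 => x _; apply/eqP; move: (np x) => /negP.
  by rewrite lt0r p0 andbT negbK.
by rewrite p1 => /eqP; rewrite oner_eq0.
Qed.

Lemma vulnerability_gt0 p : is_prior p -> 0 < vulnerability p.
Proof. by move=> /prior_gt0[x px]; apply: (lt_le_trans px); apply: le_bigmax. Qed.

Lemma cond_vulnerability_gt0 p C : is_prior p -> is_channel C ->
  0 < cond_vulnerability p C.
Proof.
move=> /prior_gt0[x px] [C0 C1]; apply: (lt_le_trans px).
(* Row [x] of [C] sums to 1, so [p x] is the sum over [y] of [p x * C x y], each term being at most
   the maximum for that [y]. *)
rewrite -[leLHS]mulr1 -(C1 x) mulr_sumr; apply: ler_sum => y _.
exact: (le_bigmax _ (fun x => p x * C x y)).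
Qed.

Lemma min_entropy_leakageE p C :
  min_entropy_leakage p C =
  log2 (cond_vulnerability p C) - log2 (vulnerability p).
Proof.
by rewrite /min_entropy_leakage /min_entropy /cond_min_entropy opprK addrC.
Qed.

End Vulnerability.

Section Log2.
Context {R : realType}.
Implicit Types x y : R.

Lemma log2M x y : 0 < x -> 0 < y -> log2 (x * y) = log2 x + log2 y.
Proof. by move=> x0 y0; rewrite /log2 lnM ?posrE // mulrDl. Qed.

Lemma log2_div x y : 0 < x -> 0 < y -> log2 (x / y) = log2 x - log2 y.
Proof. by move=> x0 y0; rewrite /log2 ln_div ?posrE // mulrBl. Qed.

Lemma ler_log2 x y : 0 < x -> x <= y -> log2 x <= log2 y.
Proof.
move=> x0 xy; rewrite ler_wpM2r ?invr_ge0 ?ln_ge0 ?ler1n //.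
by rewrite ler_ln ?posrE // (lt_le_trans x0).
Qed.

End Log2.

Section Product.
Context {R : realType} {X1 X2 Y1 Y2 : finType}.
Variables (C1 : X1 -> Y1 -> R) (C2 : X2 -> Y2 -> R).
Variables (p1 : X1 -> R) (p2 : X2 -> R).
Hypotheses (hC1 : is_channel C1) (hC2 : is_channel C2).
Hypotheses (hp1 : is_prior p1) (hp2 : is_prior p2).

Lemma parallel_channel : is_channel (parallel C1 C2).
Proof.
case: hC1 hC2 => C10 C11 [C20 C21]; split=> [x y|x]; first exact: mulr_ge0.
rewrite -(pair_bigA _ (fun y1 y2 => C1 x.1 y1 * C2 x.2 y2)) /=.
by under eq_bigr => y1 _ do rewrite -mulr_sumr C21 mulr1.
Qed.

Lemma vulnerability_prod_prior :
  vulnerability (prod_prior p1 p2) = vulnerability p1 * vulnerability p2.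
Proof. by apply: bigmax_prod; [case: hp1|case: hp2]. Qed.

(** For a fixed output pair the joint weight is [p1 x1 * C1 x1 y1] times [p2 x2 * C2 x2 y2], so the
    maximum over input pairs splits; the product of the two outer sums is the sum over output
    pairs. *)
Lemma cond_vulnerability_parallel :
  cond_vulnerability (prod_prior p1 p2) (parallel C1 C2) =
  cond_vulnerability p1 C1 * cond_vulnerability p2 C2.
Proof.
case: hC1 hC2 hp1 hp2 => C10 _ [C20 _] [p10 _] [p20 _].
rewrite /cond_vulnerability mulr_suml.
under [RHS]eq_bigr => y1 _ do rewrite mulr_sumr.
rewrite pair_bigA; apply: eq_bigr => y _.
rewrite -bigmax_prod => [|x|x]; rewrite ?mulr_ge0 //.
by apply: eq_bigr => x _; rewrite /prod_prior /parallel mulrACA.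
Qed.

Lemma min_entropy_leakage_parallel :
  min_entropy_leakage (prod_prior p1 p2) (parallel C1 C2) =
  min_entropy_leakage p1 C1 + min_entropy_leakage p2 C2.
Proof.
rewrite !min_entropy_leakageE vulnerability_prod_prior.
rewrite cond_vulnerability_parallel.
by rewrite !log2M ?vulnerability_gt0 ?cond_vulnerability_gt0 // opprD addrACA.
Qed.

End Product.

(* A scalar on each side keeps the hypotheses symmetric, so that one lemma gives
   both directions by exchanging [p] and [q]. *)
Lemma min_entropy_leakage_le (R : realType) (X Y : finType) (C : X -> Y -> R)
    (p q : X -> R) (a b c d : R) :
  is_prior p -> is_prior q -> is_channel C ->
  0 < a -> 0 < b -> 0 < c -> 0 < d ->
  (forall x, a * p x <= b * q x) -> (forall x, c * q x <= d * p x) ->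
  min_entropy_leakage p C <=
  min_entropy_leakage q C + (log2 b - log2 a) + (log2 d - log2 c).
Proof.
move=> hp hq hC a0 b0 c0 d0 pq qp.
have Vp := vulnerability_gt0 hp; have Vq := vulnerability_gt0 hq.
have Cp := cond_vulnerability_gt0 hp hC.
have Cq := cond_vulnerability_gt0 hq hC.
(* Leakage grows with the conditional vulnerability and falls with the prior one, so the former is
   bounded above through [pq] and the latter below through [qp]. *)
have := cond_vulnerability_le hC (ltW a0) (ltW b0) pq.
move=> /(ler_log2 (mulr_gt0 a0 Cp)).
have := vulnerability_le (ltW c0) (ltW d0) qp.
move=> /(ler_log2 (mulr_gt0 c0 Vq)).
rewrite !min_entropy_leakageE !log2M //; lra.
Qed.

Section Marginals.
Context {R : realType} {X1 X2 : finType}.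
Variable pi : X1 * X2 -> R.
Hypothesis hpi : is_prior pi.

Let pi0 x : 0 <= pi x. Proof. by case: hpi. Qed.

Lemma marginal1_prior : is_prior (marginal1 pi).
Proof.
split=> [x|]; first exact: sumr_ge0.
rewrite pair_bigA -[RHS](proj2 hpi).
by apply: eq_bigr => -[].
Qed.

Lemma marginal2_prior : is_prior (marginal2 pi).
Proof.
split=> [x|]; first exact: sumr_ge0.
rewrite exchange_big pair_bigA -[RHS](proj2 hpi).
by apply: eq_bigr => -[].
Qed.

Lemma prod_marginals_prior : is_prior (prod_prior (marginal1 pi) (marginal2 pi)).
Proof.
case: marginal1_prior marginal2_prior => m10 m11 [m20 m21].
split=> [x|]; first exact: mulr_ge0.
rewrite -(pair_bigA _ (fun x y => marginal1 pi x * marginal2 pi y)) /=.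
by under eq_bigr => x _ do rewrite -mulr_sumr m21 mulr1.
Qed.

Lemma dependence_ratio_gt0 x : pi x != 0 -> 0 < dependence_ratio pi x.
Proof.
move=> px; have {}px : 0 < pi x by rewrite lt0r px pi0.
rewrite divr_gt0 // mulr_gt0 //; apply: (lt_le_trans px).
  (* Each marginal is a sum of nonnegative terms, one of which is [pi x]. *)
  rewrite /marginal1 (bigD1 x.2) //= -surjective_pairing.
  by rewrite lerDl sumr_ge0.
rewrite /marginal2 (bigD1 x.1) //= -surjective_pairing.
by rewrite lerDl sumr_ge0.
Qed.

Lemma Mmax_gt0 : 0 < Mmax pi.
Proof.
have [x px] := prior_gt0 hpi; have {}px : pi x != 0 by rewrite gt_eqF.
apply: (lt_le_trans (dependence_ratio_gt0 px)).
exact: (le_bigmax_cond _ (dependence_ratio pi)).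
Qed.

(** The iterated minimum starts at [Mmax pi], so that value must be positive as well as the
    ratios. *)
Lemma Mmin_gt0 : 0 < Mmin pi.
Proof. by apply: lt_bigmin => [|x]; [exact: Mmax_gt0|exact: dependence_ratio_gt0]. Qed.

Lemma Mmin_pi_le x :
  Mmin pi * pi x <= prod_prior (marginal1 pi) (marginal2 pi) x.
Proof.
have [px|px] := eqVneq (pi x) 0.
  by rewrite px mulr0; case: prod_marginals_prior.
rewrite -ler_pdivlMr ?lt0r ?px ?pi0 //.
exact: (bigmin_le_cond _ (dependence_ratio pi)).
Qed.

(** On the support this bounds one ratio by the maximum. Off it the right side is 0, and the
    contrapositive of joint support makes the product of marginals vanish. *)
Lemma le_Mmax_pi x : jointly_supported pi ->
  prod_prior (marginal1 pi) (marginal2 pi) x <= Mmax pi * pi x.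
Proof.
move=> hs; have [px|px] := eqVneq (pi x) 0.
  rewrite px mulr0 le_eqVlt; case: eqVneq => //=; case: x px => x1 x2 px /hs.
  by rewrite px eqxx.
rewrite -ler_pdivrMr ?lt0r ?px ?pi0 //.
exact: (le_bigmax_cond _ (dependence_ratio pi)).
Qed.

End Marginals.

Theorem corollary4p2 (R : realType) (X1 X2 Y1 Y2 : finType)
    (hX1 : (0 < #|X1|)%N) (hX2 : (0 < #|X2|)%N)
    (hY1 : (0 < #|Y1|)%N) (hY2 : (0 < #|Y2|)%N)
    (pi : X1 * X2 -> R) (C1 : X1 -> Y1 -> R) (C2 : X2 -> Y2 -> R)
    (hpi : is_prior pi) (hsupp : jointly_supported pi)
    (hC1 : is_channel C1) (hC2 : is_channel C2) :
  [/\ min_entropy_leakage pi (parallel C1 C2) >=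
        min_entropy_leakage (marginal1 pi) C1
        + min_entropy_leakage (marginal2 pi) C2 - log2 (Mmax pi / Mmin pi),
      min_entropy_leakage pi (parallel C1 C2) <=
        min_entropy_leakage (marginal1 pi) C1
        + min_entropy_leakage (marginal2 pi) C2 + log2 (Mmax pi / Mmin pi) &
      (forall x1 x2, pi (x1, x2) = marginal1 pi x1 * marginal2 pi x2) ->
        min_entropy_leakage
          (prod_prior (marginal1 pi) (marginal2 pi)) (parallel C1 C2) =
        min_entropy_leakage (marginal1 pi) C1
        + min_entropy_leakage (marginal2 pi) C2].
Proof.
have h1 := marginal1_prior hpi; have h2 := marginal2_prior hpi.
have hq := prod_marginals_prior hpi; have hC := parallel_channel hC1 hC2.
have M0 := Mmax_gt0 hpi; have m0 := Mmin_gt0 hpi.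
have mq x : Mmin pi * pi x <= 1 * prod_prior (marginal1 pi) (marginal2 pi) x.
  by rewrite mul1r Mmin_pi_le.
have qM x : 1 * prod_prior (marginal1 pi) (marginal2 pi) x <= Mmax pi * pi x.
  by rewrite mul1r le_Mmax_pi.
(* The sum of leakages becomes the leakage of the product of marginals, which turns the third claim
   into an identity. *)
rewrite -!(min_entropy_leakage_parallel hC1 hC2 h1 h2) log2_div //.
(* With scalars [Mmin pi], 1, 1, [Mmax pi], and then with the roles of the priors exchanged, the
   terms [log2 1] cancel and both error terms equal [log2 (Mmax pi) - log2 (Mmin pi)]. *)
have le1 := min_entropy_leakage_le hpi hq hC m0 ltr01 ltr01 M0 mq qM.
have le2 := min_entropy_leakage_le hq hpi hC ltr01 M0 m0 ltr01 qM mq.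
by split=> //; move: le1 le2; lra.
Qed.
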